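(* Let $m\ge1$ and let $K\subset V_{2m}$ be a subset with $|K|=m+1$ having property $(\ast)$. Then: - if $m=2n$, then $\Delta_{K}\cdot (M_{i}^{2n}-\Delta_{K})=0$ in $\mathbb{Z}[\mathcal{GQ}_{4n}]/\mathcal{J}$ (for every $i\in V_{2m}$); - if $m=2n+1$, then $\Delta_{K}^{2}=0$ in $\mathbb{Z}[\mathcal{GQ}_{4n+2}]/\mathcal{J}$.
   Context: **The ring $\mathbb{Z}[\mathcal{GQ}_{2m}]$.** Let $V_{2m}=[2m+2]=\{1,\dots,2m+2\}$ and $\overline{i}=2m+3-i$ for $i\in V_{2m}$. A non-empty subset $K\subset V_{2m}$ has property $(\ast)$ if $\{i,\overline{i}\}\not\subset K$ for all $i\in V_{2m}$. Let $\mathbb{Z}[\mathcal{M},\mathcal{D}]$ be the polynomial ring over $\mathbb{Z}$ on variables $M_v$ ($v\in V_{2m}$), of degree $2$, and $\Delta_K$ ($K\subset V_{2m}$ non-empty with property $(\ast)$), of degree $4m-2|K|+2$. For $J\subset V_{2m}$ put $G_J=M_v$ if $J=V_{2m}\setminus\{v\}$, and $G_J=\Delta_J$ if $J$ is non-empty with property $(\ast)$. Let $\mathcal{I}$ be the ideal generated by: (1) all products $G_{J_1}\cdots G_{J_r}$ ($r\ge1$, each $J_s$ of one of the two kinds just described) with $J_1\cap\cdots\cap J_r=\emptyset$; (2) $(M_i+M_{\overline{i}})-(M_j+M_{\overline{j}})$ for all distinct $i,j\in V_{2m}$; (3) $\prod_{i\in I}M_i-(\Delta_{(I\cup\{a\})^c}+\Delta_{(I\cup\{\overline{a}\})^c})$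 for all $I\subset V_{2m}$ with property $(\ast)$ and $|I|=m$, where $\{a,\overline{a}\}$ is the unique such pair contained in $V_{2m}\setminus I$ and $(\cdot)^c$ is the complement in $V_{2m}$; (4) $\Delta_K\cdot M_i-\Delta_{K\setminus\{i\}}$ for all $K$ with property $(\ast)$ and $\{i\}\subsetneq K$. Then $\mathbb{Z}[\mathcal{GQ}_{2m}]:=\mathbb{Z}[\mathcal{M},\mathcal{D}]/\mathcal{I}$, and $\mathcal{J}$ is the ideal of $\mathbb{Z}[\mathcal{GQ}_{2m}]$ generated by $M_{i+1}-M_1$ for $i=1,\dots,m+1$. *)

(* Defs.v *)
From HB Require Import structures.
From mathcomp Require Import all_boot all_order all_algebra.
From mathcomp Require Import mpoly.
From mathcomp Require boolp.

Set Implicit Arguments.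
Unset Strict Implicit.
Unset Printing Implicit Defensive.

Import GRing.Theory.
Local Open Scope ring_scope.
Local Open Scope quotient_scope.

Section GeneratedIdeal.
Variable R : comNzRingType.

Definition in_ideal_gen (S : R -> Prop) (x : R) : Prop :=
  exists (n : nat) (c g : 'I_n -> R),
    (forall k, S (g k)) /\ x = \sum_(k < n) c k * g k.

(* MathComp ideals are boolean predicates, hence the classical [asbool]. *)
Definition ideal_gen (S : R -> Prop) (x : R) : bool :=
  boolp.asbool (in_ideal_gen S x).

Lemma ideal_genP S x : reflect (in_ideal_gen S x) (x \in ideal_gen S).
Proof. exact: boolp.asboolP. Qed.

Lemma mem_ideal_gen (S : R -> Prop) x : S x -> x \in ideal_gen S.
Proof.
move=> Sx; apply/ideal_genP; exists 1%N, (fun=> 1), (fun=> x); split=> //.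
by rewrite big_ord1 mul1r.
Qed.

Lemma ideal_gen_sub (S : R -> Prop) (P : {pred R}) :
  idealr_closed P -> (forall x, S x -> x \in P) -> {subset ideal_gen S <= P}.
Proof.
move=> [P0 _ PD] SP x /ideal_genP[n [c [g [Sg ->]]]].
elim/big_rec: _ => // k y _ Py; exact/PD/Py/SP/Sg.
Qed.

Lemma ideal_gen_closed (S : R -> Prop) (P : {pred R}) :
  idealr_closed P -> (forall x, S x -> x \in P) -> idealr_closed (ideal_gen S).
Proof.
move=> idP SP; have [_ P1 _] := idP; split.
- apply/ideal_genP; exists 0%N, (fun=> 0), (fun=> 0); split; first by case.
  by rewrite big_ord0.
- exact: contra (ideal_gen_sub idP SP (x:=1)) P1.
move=> a u v /ideal_genP[n [c [g [Sg ->]]]] /ideal_genP[p [d [h [Sh ->]]]].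
apply/ideal_genP; exists (n + p)%N.
exists (fun k => match split k with inl i => a * c i | inr j => d j end).
exists (fun k => match split k with inl i => g i | inr j => h j end).
split=> [k|]; first by case: split.
rewrite big_split_ord mulr_sumr; congr (_ + _); apply: eq_bigr => k _.
  by rewrite -[lshift _ _]/(unsplit (inl k)) unsplitK mulrA.
by rewrite -[rshift _ _]/(unsplit (inr k)) unsplitK.
Qed.

End GeneratedIdeal.

(* Indices start at 0: the element i of {1, .., 2m+2} is the ordinal i - 1. *)
Definition V (m : nat) : finType := 'I_(2 * m + 2).

(* i |-> 2m+3-i becomes i |-> 2m+1-i for indices starting at 0. *)
Definition bar (m : nat) (i : V m) : V m := rev_ord i.

(* Property ( * ) includes non-emptiness. *)
Definition star (m : nat) (K : {set V m}) : bool :=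
  (K != set0) && [forall i, ~~ ([set i; bar i] \subset K)].

(* The variables M_v and Delta_K. *)
Definition gqvar (m : nat) : finType := (V m + {K : {set V m} | star K})%type.

Definition gqpoly (m : nat) : comNzRingType := {mpoly int[#|gqvar m|]}.

Definition var (m : nat) (x : gqvar m) : gqpoly m := 'X_(enum_rank x).

Definition Mvar (m : nat) (v : V m) : gqpoly m := var (inl v).

(* The value 0 for K without property ( * ) is a dummy: below, [Dvar] is only
   applied to sets with this property, see [star_compl_pair] and [star_D1]. *)
Definition Dvar (m : nat) (K : {set V m}) : gqpoly m :=
  if insub K is Some L then var (inr L) else 0.

(* The set J such that G_J is the given variable. *)
Definition index_set (m : nat) (x : gqvar m) : {set V m} :=
  match x with inl v => [set~ v] | inr L => val L end.

Inductive gq_rel (m : nat) : gqpoly m -> Prop :=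
| GQ1 (s : seq (gqvar m)) :
    s != [::] -> \bigcap_(x <- s) index_set x = set0 ->
    gq_rel (\prod_(x <- s) var x)
| GQ2 (i j : V m) :
    i != j -> gq_rel ((Mvar i + Mvar (bar i)) - (Mvar j + Mvar (bar j)))
| GQ3 (I : {set V m}) (a : V m) :
    star I -> #|I| = m -> [set a; bar a] \subset ~: I ->
    gq_rel (\prod_(i in I) Mvar i -
            (Dvar (~: (I :|: [set a])) + Dvar (~: (I :|: [set bar a]))))
| GQ4 (K : {set V m}) (i : V m) :
    star K -> [set i] \proper K ->
    gq_rel (Dvar K * Mvar i - Dvar (K :\ i)).

Definition gq_ideal (m : nat) : gqpoly m -> bool := ideal_gen (@gq_rel m).

Section Facts.
Variable m : nat.
Implicit Types (K I : {set V m}) (p : gqpoly m).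

Lemma barK : involutive (@bar m).
Proof. exact: rev_ordK. Qed.

Lemma Dvar_star K (sK : star K) : Dvar K = var (inr (Sub K sK)).
Proof. by rewrite /Dvar insubT. Qed.

Lemma star_D1 K (i : V m) : star K -> [set i] \proper K -> star (K :\ i).
Proof.
case/andP=> _ /forallP sK /properP[_ [j jK]]; rewrite inE => ji.
apply/andP; split; first by apply/set0Pn; exists j; rewrite !inE ji.
apply/forallP=> k; apply: contra (sK k) => /subset_trans; apply.
exact: subD1set.
Qed.

Lemma bar_neq (i : V m) : bar i != i.
Proof.
apply/eqP=> /(congr1 val) /= /(congr1 odd).
have := ltn_ord i; move: (val i) => k; rewrite addn2 ltnS => kle.
rewrite subSS oddB // oddS oddM /=.
by case: (odd k).
Qed.

Lemma star_compl_pair I (a : V m) :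
  star I -> #|I| = m -> [set a; bar a] \subset ~: I ->
  star (~: (I :|: [set a])) && star (~: (I :|: [set bar a])).
Proof.
have dI (J : {set V m}) : star J -> [disjoint J & @bar m @: J].
  case/andP=> _ /forallP sJ; apply/pred0P=> x /=; apply/negP=> /andP[xJ].
  case/imsetP=> y yJ xy; have /negP[] := sJ y.
  by rewrite subUset !sub1set yJ -xy xJ.
have bI : injective (@bar m) by exact: can_inj barK.
move=> sI cI; rewrite subUset !sub1set !inE => /andP[aI baI].
have cov : (I :|: @bar m @: I) :|: [set a; bar a] = setT.
  apply/eqP; rewrite eqEcard subsetT /= cardsT card_ord cardsU.
  have -> : (I :|: @bar m @: I) :&: [set a; bar a] = set0.
    apply/setP=> x; rewrite !inE; apply/negP=> /andP[xI /orP[]/eqP ex];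
    move: xI; rewrite ex ?(negPf aI) ?(negPf baI) /= => /imsetP[y yI e].
      by move: baI; rewrite e barK yI.
    by move: aI; rewrite (bI _ _ e) yI.
  rewrite cards0 subn0 cards2 eq_sym bar_neq /= cardsU.
  have /disjoint_setI0 -> := dI _ sI.
  by rewrite cards0 subn0 card_imset // cI addnn mul2n.
have [I0 /forallP nI] := andP sI.
have gen b : (b = a) \/ (b = bar a) -> star (~: (I :|: [set b])).
  move=> eb; apply/andP; split.
    apply/set0Pn; exists (bar b); rewrite !inE negb_or bar_neq andbT.
    by case: eb => ->; rewrite ?barK.
  apply/forallP=> i; apply/negP; rewrite subUset !sub1set !inE !negb_or.
  case/andP=> /andP[iI ib] /andP[biI bib].
  have := in_setT i; rewrite -cov !inE (negPf iI) /=.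
  case/orP; first by case/imsetP=> y yI e; move: biI; rewrite e barK yI.
  by case: eb ib bib => -> ib bib /orP[]/eqP ei;
    move: ib bib; rewrite ei ?barK eqxx.
by rewrite !gen; [|right|left].
Qed.

Definition const0 : {pred gqpoly m} := fun p => p@_0%MM == 0.

Lemma const0_closed : idealr_closed const0.
Proof.
split; rewrite /const0 ?unfold_in /=.
- by rewrite mcoeff0.
- by rewrite mcoeff1 eqxx oner_eq0.
move=> a u v; rewrite !unfold_in => /eqP u0 /eqP v0.
by rewrite mcoeffD v0 addr0 rmorphM /= u0 mulr0.
Qed.

Lemma var_const0 (x : gqvar m) : (var x)@_0%MM = 0.
Proof. by rewrite /var mcoeffX mnm1_eq0. Qed.

Lemma Dvar_const0 K : (Dvar K)@_0%MM = 0.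
Proof. by rewrite /Dvar; case: insub => [L|]; rewrite ?var_const0 ?mcoeff0. Qed.

Lemma gq_rel_const0 p : gq_rel p -> p \in const0.
Proof.
rewrite unfold_in; case=> [[//|x s] _ _|i j _|I a sI _ _|K i _ _]; apply/eqP.
- by rewrite big_cons rmorphM /= var_const0 mul0r.
- by rewrite /Mvar mcoeffB !mcoeffD !var_const0.
- rewrite mcoeffB mcoeffD !Dvar_const0 addr0 rmorph_prod /=.
  have [/set0Pn[i iI] _] := andP sI.
  by rewrite (bigD1 i) //= var_const0 mul0r.
- by rewrite mcoeffB rmorphM /= !Dvar_const0 mul0r subrr.
Qed.

Lemma gq_ideal_closed : idealr_closed (@gq_ideal m).
Proof. exact: ideal_gen_closed const0_closed gq_rel_const0. Qed.

HB.instance Definition _ :=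
  isIdealr.Build (gqpoly m) (@gq_ideal m) gq_ideal_closed.

End Facts.

Definition gq_idealr (m : nat) : idealr (gqpoly m) :=
  Idealr.clone _ (@gq_ideal m) _.

(* The ring Z[GQ_{2m}], indexed by m. *)
Definition GQ (m : nat) : comNzRingType := {ideal_quot gq_idealr m}.

Definition gqM (m : nat) (v : V m) : GQ m := \pi_(GQ m) (Mvar v).
Definition gqD (m : nat) (K : {set V m}) : GQ m := \pi_(GQ m) (Dvar K).

(* Generators of the ideal J: M_{k+1} - M_1 for k = 1, .., m+1, that is, the
   ordinals k against 0. *)
Inductive gqJ_rel (m : nat) : GQ m -> Prop :=
| GQJ_gen (k o : V m) :
    val o = 0%N -> (1 <= k <= m + 1)%N -> gqJ_rel (gqM k - gqM o).

Definition gqJ (m : nat) : GQ m -> bool := ideal_gen (@gqJ_rel m).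

Section QuotientFacts.
Variable m : nat.

Lemma gq_eqP (p q : gqpoly m) :
  reflect (\pi_(GQ m) p = \pi_(GQ m) q) (p - q \in @gq_ideal m).
Proof. by rewrite Quotient.idealrBE; exact: eqP. Qed.

Definition const0q : {pred GQ m} := fun x => (repr x : gqpoly m)@_0%MM == 0.

Lemma const0q_pi (p : gqpoly m) : (\pi_(GQ m) p \in const0q) = (p@_0%MM == 0).
Proof.
have : p - repr (\pi_(GQ m) p) \in @gq_ideal m by apply/gq_eqP; rewrite reprK.
move/(ideal_gen_sub (@const0_closed m) (@gq_rel_const0 m)).
by rewrite !unfold_in mcoeffB subr_eq0 => /eqP ->.
Qed.

Lemma const0q_closed : idealr_closed const0q.
Proof.
have [P0 P1 PD] := @const0_closed m; split.
- by rewrite -(rmorph0 (\pi_(GQ m))) const0q_pi.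
- by rewrite -(rmorph1 (\pi_(GQ m))) const0q_pi.
move=> a u v; rewrite -[a]reprK -[u]reprK -[v]reprK -rmorphM -rmorphD.
rewrite !const0q_pi; exact: PD.
Qed.

Lemma gqJ_rel_const0 (x : GQ m) : gqJ_rel x -> x \in const0q.
Proof.
case=> k o _ _; rewrite /gqM -rmorphB const0q_pi mcoeffB.
by rewrite /Mvar !var_const0 subrr.
Qed.

Lemma gqJ_closed : idealr_closed (@gqJ m).
Proof. exact: ideal_gen_closed const0q_closed gqJ_rel_const0. Qed.

HB.instance Definition _ := isIdealr.Build (GQ m) (@gqJ m) gqJ_closed.

End QuotientFacts.

Definition gqJ_idealr (m : nat) : idealr (GQ m) :=
  Idealr.clone _ (@gqJ m) _.

(* The ring Z[GQ_{2m}]/J. *)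
Definition GQmodJ (m : nat) : comNzRingType := {ideal_quot gqJ_idealr m}.

(* Main.v *)
(* Modulo J all the M_v become equal to one element X, because the middle pair
   {m+1, m+2} lies in {1, .., m+2}.  Relation (3) then reads
   Delta_L + Delta_L' = X^m whenever L' replaces one element of the maximal set
   L by its conjugate.  The m+1 replacements that lead from K to bar K turn
   Delta_K into X^m - Delta_K (m even) or back into Delta_K (m odd), and
   Delta_K * Delta_(bar K) = 0 by relation (1). *)
Require Import Defs.
From mathcomp Require Import all_boot all_order all_algebra.
From mathcomp Require Import zify ring.

Set Implicit Arguments.
Unset Strict Implicit.
Unset Printing Implicit Defensive.

Import GRing.Theory.
Local Open Scope ring_scope.
Local Open Scope quotient_scope.

Section MaximalSets.
Variable m : nat.
Implicit Types (K L I : {set V m}) (a i : V m).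

Definition maximal_star L : bool := star L && (#|L| == m + 1)%N.

(** [bar] maps [L] injectively into its complement, and both have [m + 1] of the [2 * m + 2]
    elements, so the image is the whole complement. *)
Lemma maximal_star_bar L i : maximal_star L -> (bar i \in L) = (i \notin L).
Proof.
case/andP=> /andP[_ /forallP sL] /eqP cL.
have bI : injective (@bar m) by exact: can_inj (@barK m).
have sub : @bar m @: L \subset ~: L.
  apply/subsetP=> x /imsetP[y yL ->]; rewrite inE; apply/negP=> byL.
  by have /negP[] := sL y; rewrite subUset !sub1set yL byL.
have /eqP e : @bar m @: L == ~: L.
  rewrite eqEcard sub card_imset //.
  have := cardsC L; rewrite cL card_ord; lia.
by rewrite -in_setC -e -{2}(barK i) mem_imset.
Qed.

Lemma bar_maximal_star L :
  #|L| = (m + 1)%N -> (forall i, (bar i \in L) = (i \notin L)) ->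
  maximal_star L.
Proof.
move=> cL bL; apply/andP; split; last exact/eqP.
apply/andP; split; first by rewrite -card_gt0 cL addn1.
by apply/forallP=> i; rewrite subUset !sub1set bL andbN.
Qed.

Definition exchange a L : {set V m} := bar a |: L :\ a.

Lemma maximal_star_exchange a L :
  maximal_star L -> a \in L -> maximal_star (exchange a L).
Proof.
move=> mL aL; have /andP[_ /eqP cL] := mL.
apply: bar_maximal_star => [|i].
  rewrite cardsU1 !inE (negPf (bar_neq a)) /= maximal_star_bar // aL /=.
  by rewrite -cL (cardsD1 a L) aL.
rewrite !inE (inj_eq (can_inj (@barK m))) maximal_star_bar //.
have [->|ia] := eqVneq i a; first by rewrite /= orbF eq_sym bar_neq.
have [->|iba] := eqVneq i (bar a); first by rewrite barK eqxx.
have -> // : bar i != a by apply: contra iba => /eqP <-; rewrite barK.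
Qed.

Lemma maximal_star_setC L : maximal_star L -> maximal_star (~: L).
Proof.
move=> mL; have /andP[_ /eqP cL] := mL; apply: bar_maximal_star => [|i].
  by have := cardsC L; rewrite cL card_ord; lia.
by rewrite !inE maximal_star_bar.
Qed.

End MaximalSets.

Section Relations.
Variable m : nat.
Implicit Types (K L I : {set V m}) (a i j : V m).

Local Notation pr p := (\pi_(GQmodJ m) (\pi_(GQ m) p)).

Lemma pr_rel (p : gqpoly m) : gq_rel p -> pr p = 0.
Proof.
move=> rp; suff -> : \pi_(GQ m) p = 0 by rewrite rmorph0.
rewrite -(rmorph0 \pi_(GQ m)); apply/gq_eqP; rewrite subr0.
exact: mem_ideal_gen.
Qed.

Lemma pr_gqJ (x : GQ m) : gqJ_rel x -> \pi_(GQmodJ m) x = 0.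
Proof.
move=> rx; rewrite -(rmorph0 \pi_(GQmodJ m)); apply/eqP.
rewrite -Quotient.idealrBE subr0; exact: mem_ideal_gen.
Qed.

Lemma pr_Mvar_eq i j : pr (Mvar i) = pr (Mvar j).
Proof.
have o_lt : (0 < 2 * m + 2)%N by rewrite addn2.
pose o : V m := Ordinal o_lt.
have low (k : V m) : (k <= m + 1)%N -> pr (Mvar k) = pr (Mvar o).
  have [k0|k_gt0] := posnP k.
    by move=> _; congr (pr (Mvar _)); apply: val_inj.
  move=> k_le; apply/eqP; rewrite -subr_eq0 -rmorphB; apply/eqP.
  by apply: pr_gqJ; apply: GQJ_gen; rewrite // k_gt0.
(* With indices from 0 the middle pair is [c = m] and [bar c = m + 1]; both fall under [low], which
   fixes the common pair sum of relation (2). *)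
have c_lt : (m < 2 * m + 2)%N by lia.
pose c : V m := Ordinal c_lt.
have pair k : pr (Mvar k) + pr (Mvar (bar k)) = pr (Mvar o) + pr (Mvar o).
  transitivity (pr (Mvar c) + pr (Mvar (bar c))).
    have [->//|kc] := eqVneq k c.
    have /pr_rel := GQ2 kc; rewrite !rmorphB !rmorphD /= => /eqP.
    by rewrite subr_eq0 => /eqP.
  by rewrite !low //=; lia.
suff all k : pr (Mvar k) = pr (Mvar o) by rewrite !all.
(* Beyond [m + 1] the conjugate [bar k] is low, so it cancels from the pair sum. *)
have [/low//|k_gt] := leqP k (m + 1).
have := pair k; rewrite (low (bar k)); first by move/addIr.
by rewrite /=; have := ltn_ord k; lia.
Qed.

Hypothesis m_ge1 : (1 <= m)%N.

Lemma pr_Dvar_exchange a L i : maximal_star L -> a \in L ->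
  pr (Dvar (exchange a L)) = pr (Mvar i) ^+ m - pr (Dvar L).
Proof.
move=> mL aL; have mC := maximal_star_setC mL.
have /andP[/andP[_ /forallP sC] /eqP cC] := mC.
have baC : bar a \in ~: L by rewrite inE maximal_star_bar // aL.
(* This [I] avoids exactly [L] and [bar a], so the two complements in relation (3) are [L] and
   [exchange a L]. *)
pose I := ~: L :\ bar a.
have cI : #|I| = m.
  by have := cardsD1 (bar a) (~: L); rewrite baC cC addn1 => -[].
have sI : star I.
  (* Non-emptiness of [I] is where [m_ge1] enters. *)
  apply/andP; split; first by rewrite -card_gt0 cI.
  by apply/forallP=> k; apply: contra (sC k) => /subset_trans; apply; exact: subD1set.
have aI : [set a; bar a] \subset ~: I.
  by rewrite subUset !sub1set !inE aL eqxx /= andbF.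
have eL : ~: (I :|: [set bar a]) = L by rewrite setUC setD1K // setCK.
have eE : ~: (I :|: [set a]) = exchange a L.
  apply/setP=> x; rewrite !inE negb_or negb_and !negbK.
  have [->|_] := eqVneq x (bar a); first by rewrite bar_neq.
  by rewrite andbC.
have /pr_rel := GQ3 sI cI aI; rewrite eL eE !(rmorphB, rmorphD, rmorph_prod) => /eqP.
rewrite (eq_bigr (fun=> pr (Mvar i))) => [|k _]; last exact: pr_Mvar_eq.
by rewrite prodr_const cI subr_eq0 => /eqP ->; rewrite addrK.
Qed.

(** Each exchange applies the involution that sends x to X^m - x, so only the parity of the number
    of exchanges between [K] and [L] matters. *)
Lemma pr_Dvar_parity K L i : maximal_star K -> maximal_star L ->
  pr (Dvar L) = if odd #|K :\: L| then pr (Mvar i) ^+ m - pr (Dvar K)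
                else pr (Dvar K).
Proof.
move=> mK; move en : #|K :\: L| => n; elim: n L en => [|n IHn] L en mL.
  congr (pr (Dvar _)); apply/esym/eqP; rewrite eqEcard.
  have /andP[_ /eqP ->] := mK; have /andP[_ /eqP ->] := mL.
  by rewrite leqnn andbT -setD_eq0 -cards_eq0 en.
(* Trading [bar b] for [b] in [L] removes exactly [b] from the difference with [K]. *)
have /card_gt0P[b /setDP[bK bL]] : (0 < #|K :\: L|)%N by rewrite en.
have aL : bar b \in L by rewrite maximal_star_bar.
have mE := maximal_star_exchange mL aL.
have eE : K :\: exchange (bar b) L = (K :\: L) :\ b.
  apply/setP=> x; rewrite !inE barK negb_or negb_and negbK.
  have [->|_] := eqVneq x (bar b); last by rewrite /= andbA.
  by rewrite (maximal_star_bar _ mK) bK !andbF.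
have cE : #|K :\: exchange (bar b) L| = n.
  by have := cardsD1 b (K :\: L); rewrite eE !inE bK bL en => -[].
have := IHn _ cE mE; rewrite (pr_Dvar_exchange i mL aL) /=.
case: (odd n) => /= e; last by rewrite -e; ring.
by move: e => /addrI /oppr_inj.
Qed.

(** For maximal [K] the conjugate set is [~: K]; the two index sets are disjoint, so relation (1)
    with two factors applies. *)
Lemma pr_Dvar_setC K : maximal_star K -> pr (Dvar K) * pr (Dvar (~: K)) = 0.
Proof.
move=> mK; have /andP[sK _] := mK.
have /andP[sC _] := maximal_star_setC mK.
pose s : seq (gqvar m) := [:: inr (Sub K sK); inr (Sub (~: K) sC)].
have s0 : \bigcap_(x <- s) index_set x = set0.
  by rewrite !big_cons big_nil /= setIT setICr.
have /pr_rel := GQ1 (isT : s != [::]) s0.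
by rewrite !big_cons big_nil mulr1 -!Dvar_star !rmorphM.
Qed.

End Relations.

Theorem corollary7p3 (m : nat) (m_ge1 : (1 <= m)%N)
    (K : {set V m}) (cardK : #|K| = (m + 1)%N) (starK : star K) :
  (forall n : nat, m = (2 * n)%N ->
     forall i : V m,
       \pi_(GQmodJ m) (gqD K * (gqM i ^+ (2 * n) - gqD K)) = 0) /\
  (forall n : nat, m = (2 * n + 1)%N ->
     \pi_(GQmodJ m) (gqD K ^+ 2) = 0).
Proof.
have mK : maximal_star K by rewrite /maximal_star starK cardK eqxx.
have mC := maximal_star_setC mK.
(* Going from [K] to [~: K] takes [m + 1] exchanges, hence an odd number exactly when [m] is
   even. *)
have eD : K :\: ~: K = K by rewrite setDE setCK setIid.
have DC := pr_Dvar_setC mK.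
split=> n mn => [i|].
  have evm : odd m = false by rewrite mn oddM.
  (* Writing 0 as the product in [DC] leaves only the second factors to compare. *)
  rewrite -mn rmorphM rmorphB rmorphXn -[RHS]DC.
  by rewrite (pr_Dvar_parity m_ge1 i mK mC) eD cardK addn1 /= evm.
have odm : odd m by rewrite mn addn1 /= oddM.
(* Any index [i] serves to name X in [pr_Dvar_parity]. *)
have /card_gt0P[i _] : (0 < #|K|)%N by rewrite cardK addn1.
rewrite rmorphXn expr2 -[RHS]DC (pr_Dvar_parity m_ge1 i mK mC) eD cardK.
by rewrite addn1 /= odm.
Qed.
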